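(* Let $h\ge 1$ be an integer and let $G=(V,E)$ be a directed graph with non-negative edge weights whose underlying undirected graph is $K_h$-minor-free. For $v\in V$ and $r\ge 0$ let $\overrightarrow{B}(v,r)=\{u\in V: d_G(v\rightarrow u)\le r\}$, and let $\overrightarrow{\mathcal{B}}(G)=\{\overrightarrow{B}(v,r): v\in V, r\ge 0\}$, a family of subsets of $V$. Then $\overrightarrow{\mathcal{B}}(G)$ has VC-dimension at most $h-1$.
   Context: $d_G(u\rightarrow v)$ denotes the length of a shortest directed path from $u$ to $v$. For a family $\mathcal{F}$ of subsets of a ground set $U$, a set $Y\subseteq U$ is shattered by $\mathcal{F}$ if $\{Y\cap F: F\in\mathcal{F}\}=2^Y$; the VC-dimension of $\mathcal{F}$ is the maximum size of a shattered set. *)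

(* Defs.v *)
From HB Require Import structures.
From mathcomp Require Import all_boot all_order all_algebra.
From mathcomp Require Import boolp classical_sets reals ereal.

Set Implicit Arguments.
Unset Strict Implicit.
Unset Printing Implicit Defensive.

Import Order.TTheory GRing.Theory Num.Theory.

Local Open Scope ring_scope.

Definition underlying (V : finType) (e : rel V) : rel V :=
  [rel x y | (x != y) && (e x y || e y x)].

Definition complete_graph (h : nat) : rel 'I_h := [rel i j | i != j].
Arguments complete_graph : clear implicits.

Definition connected_in (V : finType) (g : rel V) (B : {set V}) : Prop :=
  forall x y, x \in B -> y \in B ->
    connect [rel a b | [&& a \in B, b \in B & g a b]] x y.

(* Branch-set model; [g] and [k] are meant to be symmetric. *)
Definition is_minor (S V : finType) (k : rel S) (g : rel V) : Prop :=
  exists B : S -> {set V},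
    [/\ forall i, B i != finset.set0,
        forall i, connected_in g (B i),
        forall i j, i != j -> [disjoint B i & B j] &
        forall i j, k i j -> exists x y, [/\ x \in B i, y \in B j & g x y]].

Definition path_length (R : realType) (V : finType) (w : V -> V -> R)
    (u : V) (p : seq V) : R :=
  \sum_(a <- zip (u :: p) p) w a.1 a.2.

Definition directed_path (V : finType) (e : rel V) (u v : V) (p : seq V) : bool :=
  [&& path e u p, uniq (u :: p) & last u p == v].

(* A finite graph has finitely many directed paths, so the infimum is a minimum
   when [v] is reachable from [u]; otherwise it is [+oo]. *)
Definition dist (R : realType) (V : finType) (e : rel V) (w : V -> V -> R)
    (u v : V) : \bar R :=
  ereal_inf [set l | exists2 p, directed_path e u v p
                              & l = (path_length w u p)%:E]%classic.

Definition out_ball (R : realType) (V : finType) (e : rel V) (w : V -> V -> R)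
    (v : V) (r : R) : {set V} :=
  [set u : V | (dist e w v u <= r%:E)%E]%SET.

Definition out_balls (R : realType) (V : finType) (e : rel V) (w : V -> V -> R) :
    set {set V} :=
  [set B | exists (v : V) (r : R), 0 <= r /\ B = out_ball e w v r]%classic.

Definition shattered (U : finType) (F : set {set U}) (Y : {set U}) : Prop :=
  [set Z | exists2 X, F X & Z = Y :&: X]%classic =
  [set Z | Z \in powerset Y]%classic.

(* Equals 0 for the empty family, which shatters no set at all. *)
Definition vc_dim (U : finType) (F : set {set U}) : nat :=
  (\max_(Y : {set U} | `[< shattered F Y >]) #|Y|)%N.

(* Main.v *)
(** Let [Y] be a shattered set. Assign to each vertex the terminal of [Y] that is
    closest to it for the distance *towards* the terminal, breaking ties by a
    fixed ordering of the vertices. Each of the resulting in-Voronoi cells is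
    connected, since the whole shortest path from [x] to its nearest terminal
    lies in the cell of [x]; it contains its terminal, because [Y] meets some
    ball in that terminal only. For distinct terminals [y] and [z], let [B] be a
    ball with center [v] and [Y :&: B = {y, z}]. All vertices on shortest paths
    from [v] to [y] or [z] have their nearest terminal in [B], so [v] is in one
    of the cells of [y] and [z], and the shortest path from [v] to the other
    terminal crosses an edge between the two cells. Hence the cells are the
    branch sets of a complete minor on [#|Y|] vertices. *)

Require Import Defs.
From HB Require Import structures.
From mathcomp Require Import all_boot all_order all_algebra.
From mathcomp Require Import boolp classical_sets reals ereal.

Import Order.TTheory GRing.Theory Num.Theory.

Local Open Scope ring_scope.

Section WeightedDigraph.
Context {R : realType} {V : finType} (e : rel V) (w : V -> V -> R).
Hypothesis w_ge0 : forall x y, e x y -> 0 <= w x y.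
Implicit Types (u v x y z : V) (p q : seq V) (Y : {set V}).

(** * Walk lengths and distances *)

Local Notation len := (path_length w).
Local Notation d := (dist e w).

Lemma path_length_nil u : len u [::] = 0.
Proof. by rewrite /path_length big_nil. Qed.

Lemma path_length_cons u v p : len u (v :: p) = w u v + len v p.
Proof. by rewrite /path_length /= big_cons. Qed.

Lemma path_length_cat u p q : len u (p ++ q) = len u p + len (last u p) q.
Proof.
elim: p u => [|v p IH] u; first by rewrite path_length_nil add0r.
by rewrite cat_cons !path_length_cons IH addrA.
Qed.

Lemma path_length_ge0 u p : path e u p -> 0 <= len u p.
Proof.
elim: p u => [|v p IH] u /=; first by rewrite path_length_nil.
by case/andP=> euv pvp; rewrite path_length_cons addr_ge0 ?w_ge0 ?IH.
Qed.

(** Loop erasure: if the first vertex recurs later, the cycle before its recurrence is cut off, and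
    non-negative weights keep the rest from being longer. *)
Lemma walk_directed_path u p : path e u p ->
  exists2 q, directed_path e u (last u p) q & len u q <= len u p.
Proof.
elim: p u => [|v p IH] u /=; first by exists [::]; rewrite // /directed_path /= eqxx.
case/andP=> euv /IH[q /and3P[pq uq lq] leq]; rewrite path_length_cons.
have [uvq|nuvq] := boolP (u \in v :: q); last first.
  exists (v :: q); last by rewrite path_length_cons lerD2l.
  by rewrite /directed_path cons_uniq uq nuvq /= euv pq lq.
move: pq uq lq leq; case/splitPl: uvq => q1 q2 lq1.
rewrite cat_path -cat_cons cat_uniq last_cat path_length_cat lq1.
case/andP=> pq1 pq2 /and3P[_ nq1 uq2] lq2 leq.
exists q2.
  rewrite /directed_path pq2 lq2 cons_uniq uq2 !andbT.
  by apply: contra nq1 => uq; apply/hasP; exists u => //; rewrite -lq1 mem_last.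
apply: le_trans (le_trans leq _); first by rewrite lerDr path_length_ge0.
by rewrite lerDr w_ge0.
Qed.

Lemma dist_le_path_length u p : path e u p -> (d u (last u p) <= (len u p)%:E)%E.
Proof.
move=> /walk_directed_path[q dq leq].
apply: (@le_trans _ _ (len u q)%:E); last by rewrite lee_fin.
by apply: ereal_inf_lbound; exists q.
Qed.

Lemma dist_refl_le0 u : (d u u <= 0)%E.
Proof. by have := @dist_le_path_length u [::] isT; rewrite path_length_nil. Qed.

Variant dist_spec u v : \bar R -> Prop :=
| DistInfinite : dist_spec u v +oo%E
| DistPath p of path e u p & last u p = v : dist_spec u v (len u p)%:E.

Lemma distP u v : dist_spec u v (d u v).
Proof.
(* Simple paths live in the finite type of sequences of size at most [#|V|], so the infimum is
   attained. *)
pose P (p : #|V|.-bseq V) := directed_path e u v p.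
have sizeP p : directed_path e u v p -> (size p <= #|V|)%N.
  case/and3P=> _ /=/andP[_ up] _.
  by rewrite -(card_uniqP up) max_card.
have [p0 Pp0|noP] := pickP P; last first.
  suff -> : d u v = +oo%E by constructor.
  rewrite /dist (_ : [set l | _]%classic = set0) ?ereal_inf0 //.
  apply/seteqP; split=> // l [p dp _].
  by have := noP (Bseq (sizeP p dp)); rewrite /P dp.
have [p Pp minp] := @Order.TotalTheory.arg_minP _ R _ p0 P (fun p : #|V|.-bseq V => len u p) Pp0.
suff -> : d u v = (len u p)%:E by case/and3P: Pp => pp _ /eqP; constructor.
apply/eqP; rewrite eq_le; apply/andP; split.
  by apply: ereal_inf_lbound; exists p.
apply/ereal_infP => _ [q dq ->]; rewrite lee_fin.
exact: (minp (Bseq (sizeP q dq))).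
Qed.

Lemma dist_triangle_walk u p v :
  path e u p -> (d u v <= (len u p)%:E + d (last u p) v)%E.
Proof.
move=> pp; case: (distP (last u p) v) => [|q pq <-]; first by rewrite addey ?leey.
rewrite -EFinD -path_length_cat -last_cat; apply: dist_le_path_length.
by rewrite cat_path pp.
Qed.

Lemma dist_triangle u v x : (d u x <= d u v + d v x)%E.
Proof.
case: (distP u v) => [|p pp <-]; last exact: dist_triangle_walk.
by case: (distP v x) => [|q _ _]; rewrite leey.
Qed.

(** * Shortest walks *)

Definition shortest_walk u p := path e u p /\ d u (last u p) = (len u p)%:E.

Lemma shortest_walk_ex u v :
  (d u v < +oo)%E -> exists2 p, shortest_walk u p & last u p = v.
Proof.
rewrite /shortest_walk => duv; have := erefl (d u v).
case: {2}(d u v) / (distP u v) => [duvE|p pp <- dE]; first by rewrite duvE in duv.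
by exists p.
Qed.

(** Follow the walk up to [z], then turn off towards [y]: this is no longer than staying on the
    walk. *)
Lemma shortest_walk_le u p z y : shortest_walk u p -> z \in u :: p ->
  (d z y <= d z (last u p))%E -> (d u y <= d u (last u p))%E.
Proof.
case=> pp dE zp; move: pp dE; case/splitPl: zp => p1 p2 lp1.
rewrite cat_path last_cat path_length_cat lp1 => /andP[pp1 pp2] -> le_zy.
have := dist_triangle_walk u p1 y pp1; rewrite lp1 => /le_trans; apply.
rewrite EFinD leeD2l // (le_trans le_zy) //.
exact: dist_le_path_length.
Qed.

Lemma shortest_walk_fin u p z :
  shortest_walk u p -> z \in u :: p -> (d z (last u p) < +oo)%E.
Proof.
case=> pp _ zp; move: pp; case/splitPl: zp => p1 p2 lp1.
rewrite cat_path last_cat lp1 => /andP[_ /dist_le_path_length /le_lt_trans].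
by apply; rewrite ltey.
Qed.

(** * In-Voronoi cells *)

(** Finiteness leaves out the vertices that reach no terminal, at which all distances tie at [+oo];
    [enum_rank] breaks the other ties. *)
Definition voronoi Y y : {set V} :=
  [set x : V | (d x y < +oo)%E &&
    [forall z in Y, (d x y <= d x z)%E &&
       ((d x z <= d x y)%E ==> (enum_rank y <= enum_rank z)%N)]]%SET.

Lemma voronoiP Y y x :
  reflect ((d x y < +oo)%E /\ forall z, z \in Y -> (d x y <= d x z)%E /\
             ((d x z <= d x y)%E -> (enum_rank y <= enum_rank z)%N))
          (x \in voronoi Y y).
Proof.
rewrite inE; apply: (iffP andP) => -[fin_y min_y]; split=> //.
  by move=> z zY; have /andP[-> /implyP] := forall_inP min_y z zY.
by apply/forall_inP=> z /min_y[-> /implyP].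
Qed.

Lemma voronoi_ex Y x y0 : y0 \in Y -> (d x y0 < +oo)%E ->
  exists y, [/\ y \in Y, x \in voronoi Y y & (d x y <= d x y0)%E].
Proof.
move=> y0Y fin0.
have [m mY min_m] :=
  @Order.TotalTheory.arg_minP _ (\bar R) _ y0 (mem Y) (fun y => d x y) y0Y.
(* Among the terminals at minimal distance, take the one of least rank. *)
pose P y := (y \in Y) && (d x y <= d x m)%E.
have Pm : P m by rewrite /P lexx andbT.
have [y /andP[yY ym] min_y] := @arg_minnP _ m P (fun y => enum_rank y) Pm.
exists y; split=> //; last exact: le_trans ym (min_m _ y0Y).
apply/voronoiP; split; first exact: le_lt_trans ym (le_lt_trans (min_m _ y0Y) fin0).
move=> z zY; split=> [|zy]; first exact: le_trans ym (min_m _ zY).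
by apply: min_y; rewrite /P zY (le_trans zy).
Qed.

Lemma voronoi_inj Y x y z : y \in Y -> z \in Y ->
  x \in voronoi Y y -> x \in voronoi Y z -> y = z.
Proof.
move=> yY zY /voronoiP[_ /(_ z zY)[yz ryz]] /voronoiP[_ /(_ y yY)[zy rzy]].
by apply/enum_rank_inj/val_inj/eqP; rewrite eqn_leq ryz ?rzy.
Qed.

Lemma voronoi_shortest_walk Y x p z : x \in voronoi Y (last x p) ->
  shortest_walk x p -> z \in x :: p -> z \in voronoi Y (last x p).
Proof.
move=> /voronoiP[_ min_y] sp zp; apply/voronoiP; split.
  exact: shortest_walk_fin sp zp.
move=> t tY; have [yt ryt] := min_y t tY.
have xle := shortest_walk_le x p z t sp zp; split=> [|/xle/ryt //].
(* If [t] were strictly closer to [z], then the detour through [z] to [t] would beat the shortest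
   walk from [x]; the finite length of [p1] cancels. *)
case: leP => // tz; have pp := sp.1; have dE := sp.2.
move: pp dE tz yt; case/splitPl: zp => p1 p2 lp1.
rewrite cat_path last_cat path_length_cat lp1 => /andP[pp1 pp2] -> tz.
have := dist_triangle_walk x p1 t pp1; rewrite lp1 => xt /le_trans/(_ xt).
rewrite EFinD leeD2lE // => yt.
have := dist_le_path_length z p2 pp2 => /le_trans/(_ yt).
by rewrite leNgt tz.
Qed.

(** * Walks in the underlying graph *)

Lemma underlying_sym : symmetric (underlying e).
Proof. by move=> x y; rewrite /underlying /= eq_sym orbC. Qed.

Lemma walk_connect_in (B : {set V}) x p : path e x p -> {subset x :: p <= B} ->
  connect [rel a b | [&& a \in B, b \in B & underlying e a b]] x (last x p).
Proof.
elim: p x => [|z p IH] x /=; first by rewrite connect0.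
case/andP=> exz pp sB.
apply: (connect_trans _ (IH z pp _)); last by move=> t tp; rewrite sB // inE tp orbT.
have [->|nxz] := eqVneq x z; first exact: connect0.
have xB : x \in B by rewrite sB ?mem_head.
have zB : z \in B by rewrite sB // inE mem_head orbT.
by apply: connect1; rewrite /underlying /= xB zB nxz exz.
Qed.

Lemma voronoi_connected Y y : connected_in (underlying e) (voronoi Y y).
Proof.
pose E := [rel a b | [&& a \in voronoi Y y, b \in voronoi Y y & underlying e a b]].
have to_y x : x \in voronoi Y y -> connect E x y.
  move=> xy; have /voronoiP[/shortest_walk_ex[p sp lp] _] := xy.
  subst y; apply: walk_connect_in; first by case: sp.
  by move=> z; apply: voronoi_shortest_walk.
have symE : connect_sym E.
  by apply: sym_connect_sym => a b /=; rewrite underlying_sym andbCA.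
by move=> x z /to_y xy /to_y zy; rewrite (connect_trans xy) // symE.
Qed.

Lemma path_crossing (A B : {set V}) x p : path e x p -> x \in A ->
  last x p \in B -> {subset x :: p <= A :|: B} -> [disjoint A & B] ->
  exists a b, [/\ a \in A, b \in B & underlying e a b].
Proof.
move=> pp xA lB sAB dAB.
have AnB a : a \in A -> a \in B = false by move=> aA; apply: (disjointFr dAB).
elim: p x pp xA lB sAB => [|z p IH] x /=; first by move=> _ /AnB->.
case/andP=> exz pp xA lB sAB.
have sAB' : {subset z :: p <= A :|: B} by move=> t tp; rewrite sAB // inE tp orbT.
have := sAB' z (mem_head _ _); rewrite finset.in_setU => /orP[zA|zB]; first exact: IH pp zA _ _.
exists x, z; split=> //; rewrite /underlying /= exz andbT.
by apply: contraTneq zB => <-; rewrite AnB.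
Qed.

(** * Cells of a shattered set *)

Lemma shatteredP Y : shattered (out_balls e w) Y -> forall Z : {set V}, Z \subset Y ->
  exists v r, forall y, y \in Y -> (d v y <= r%:E)%E = (y \in Z).
Proof.
move=> shY Z ZY.
have : [set Z0 | Z0 \in powerset Y]%classic Z by rewrite /= powersetE.
rewrite -shY => -[_ [v [r [_ ->]]] ->]; exists v, r => y yY.
by rewrite inE yY inE.
Qed.

(** Zero-length paths could put [y] in the cell of another terminal [z]. But then [d y z <= 0], so
    every ball containing [y] contains [z], even the one that meets [Y] in [y] only. *)
Lemma mem_voronoi Y y : shattered (out_balls e w) Y -> y \in Y -> y \in voronoi Y y.
Proof.
move=> /shatteredP shY yY.
have [|v [r ball]] := shY [set y]%SET; first by rewrite finset.sub1set.
have dyy := dist_refl_le0 y.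
have [|z [zY yz zle]] := @voronoi_ex Y y y yY; first exact: le_lt_trans dyy (ltey _).
suff : z \in [set y]%SET by rewrite finset.in_set1 => /eqP zy; rewrite zy in yz.
rewrite -ball // (le_trans (dist_triangle v y z)) //.
have : (d v y <= r%:E)%E by rewrite ball // finset.set11.
by apply: le_trans; rewrite geeDl // (le_trans zle).
Qed.

Lemma voronoi_disjoint Y y z : y \in Y -> z \in Y -> y != z ->
  [disjoint voronoi Y y & voronoi Y z].
Proof.
move=> yY zY nyz; apply/pred0P => x /=; apply/negP => /andP[xy xz].
by move/eqP: nyz; apply; apply: voronoi_inj xy xz.
Qed.

Lemma voronoi_adjacent Y y z : shattered (out_balls e w) Y ->
  y \in Y -> z \in Y -> y != z ->
  exists a b, [/\ a \in voronoi Y y, b \in voronoi Y z & underlying e a b].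
Proof.
move=> shY yY zY nyz.
have [|v [r ball]] := shatteredP Y shY [set y; z]%SET.
  by apply/fintype.subsetP=> t; rewrite !inE => /orP[]/eqP->.
have vy : (d v y <= r%:E)%E by rewrite ball // !inE eqxx.
have vz : (d v z <= r%:E)%E by rewrite ball // !inE eqxx orbT.
have [|t [tY vt tle]] := @voronoi_ex Y v y yY; first exact: le_lt_trans vy (ltey _).
have tyz : t \in [set y; z]%SET by rewrite -ball // (le_trans tle).
(* Here [t] is the terminal whose cell contains [v], and [s] will be the other one of [y] and
   [z]. *)
have cross s : s \in Y -> (d v s <= r%:E)%E -> s != t ->
    [set y; z]%SET = [set t; s]%SET ->
    exists a b, [/\ a \in voronoi Y t, b \in voronoi Y s & underlying e a b].
  move=> sY vs nst eqts.
  have [|p sp lp] := @shortest_walk_ex v s; first exact: le_lt_trans vs (ltey _).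
  apply: (path_crossing _ _ v p) => //; first by case: sp.
  - by rewrite lp mem_voronoi.
  (* The terminal [s'] of [x] is no farther from [x] than [s], hence no farther from [v], so it lies
     in the ball. *)
  - move=> x xp; have := shortest_walk_fin v p x sp xp; rewrite lp.
    move=> /(@voronoi_ex Y x s sY)[s' [s'Y xs' s'le]].
    have : s' \in [set y; z]%SET.
      rewrite -ball //; apply: le_trans vs.
      by have := shortest_walk_le v p x s' sp xp; rewrite lp; apply.
    by rewrite eqts finset.in_set2 finset.in_setU => /orP[]/eqP<-; rewrite xs' ?orbT.
  - by apply: voronoi_disjoint; rewrite // eq_sym.
move: tyz; rewrite !inE => /orP[]/eqP ty; subst t.
  by apply: cross => //; rewrite eq_sym.
have [//|//|//||a [b [az byy ab]]] := cross y; first by rewrite finset.setUC.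
by exists b, a; rewrite underlying_sym.
Qed.

Lemma shattered_complete_minor Y h : shattered (out_balls e w) Y -> (h <= #|Y|)%N ->
  is_minor (complete_graph h) (underlying e).
Proof.
(* The cells are taken with respect to all of [Y], but only [h] of them serve as branch sets. *)
move=> shY hY; pose t (i : 'I_h) : V := enum_val (widen_ord hY i).
have tY i : t i \in Y by apply: enum_valP.
have t_inj : injective t.
  by move=> i j /enum_val_inj/(congr1 val) ij; apply: val_inj.
exists (fun i => voronoi Y (t i)); split=> [i|i|i j nij|i j nij].
- by apply/finset.set0Pn; exists (t i); apply: mem_voronoi.
- exact: voronoi_connected.
- by apply: voronoi_disjoint; rewrite ?inj_eq.
- by apply: voronoi_adjacent; rewrite ?inj_eq.
Qed.

End WeightedDigraph.

Theorem theorem1p5 (R : realType) (h : nat) (V : finType) (e : rel V)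
    (w : V -> V -> R)
    (h_ge1 : (1 <= h)%N)
    (w_ge0 : forall x y, e x y -> 0 <= w x y)
    (minor_free : ~ is_minor (complete_graph h) (underlying e)) :
  (vc_dim (out_balls e w) <= h - 1)%N.
Proof.
apply/bigmax_leqP => Y /asboolP shY; rewrite -ltnS subn1 prednK // ltnNge.
apply/negP => hY; apply: minor_free.
exact: shattered_complete_minor _ _ w_ge0 _ _ shY hY.
Qed.
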